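(* If $G$ is an existentially closed group, then $G$ is not amenable.
   Context: A group $G$ is existentially closed (e.c.) if, for any finite system $p(\vec x)$ of equations and inequations (expressions $w=e$ or $w\neq e$ with $w$ a word in the variables $\vec x$, their inverses, and elements of $G$) with coefficients from $G$, if there is a solution to $p(\vec x)$ in some group extension of $G$ (a group containing $G$ as a subgroup), then there is a solution to $p(\vec x)$ in $G$. For a group $G$, a finite subset $F\subseteq G$ and $\epsilon>0$, a finite subset $H\subseteq G$ is an $(F,\epsilon)$-Følner set if $|gH\triangle H|<\epsilon|H|$ for all $g\in F$. The (discrete) group $G$ is amenable if, for every finite subset $F\subseteq G$ and every $\epsilon>0$, there is an $(F,\epsilon)$-Følner subset of $G$. *)

(* Defs.v *)
From HB Require Import structures.
From mathcomp Require Import all_boot all_order all_algebra.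
From mathcomp Require Import finmap reals.

Set Implicit Arguments.
Unset Strict Implicit.
Unset Printing Implicit Defensive.

Local Open Scope group_scope.

Inductive letter (G : Type) (n : nat) :=
  | Coef of G
  | Var of 'I_n
  | VarInv of 'I_n.

Definition word (G : Type) (n : nat) := seq (letter G n).

Inductive literal (G : Type) (n : nat) :=
  | Equation of word G n
  | Inequation of word G n.

Definition system (G : Type) (n : nat) := seq (literal G n).

(* The coefficients are read in K through f : G -> K. *)
Definition letter_val (G : Type) (n : nat) (K : groupType) (f : G -> K)
    (x : 'I_n -> K) (l : letter G n) : K :=
  match l with
  | Coef g => f g
  | Var i => x i
  | VarInv i => (x i)^-1
  end.

Definition word_val (G : Type) (n : nat) (K : groupType) (f : G -> K)
    (x : 'I_n -> K) (w : word G n) : K :=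
  \prod_(l <- w) letter_val f x l.

Definition literal_holds (G : Type) (n : nat) (K : groupType) (f : G -> K)
    (x : 'I_n -> K) (c : literal G n) : bool :=
  match c with
  | Equation w => word_val f x w == 1
  | Inequation w => word_val f x w != 1
  end.

Definition solution (G : Type) (n : nat) (K : groupType) (f : G -> K)
    (p : system G n) (x : 'I_n -> K) : bool :=
  all (literal_holds f x) p.

(* A group extension of G is a group K with an injective morphism
   f : G -> K; solutions in G itself use f = id. *)
Definition existentially_closed (G : groupType) : Prop :=
  forall (n : nat) (p : system G n),
    (exists (K : groupType) (f : {multiplicative G -> K}),
        injective f /\ exists x : 'I_n -> K, solution f p x) ->
    exists x : 'I_n -> G, solution id p x.

Definition ltranslate (G : groupType) (g : G) (H : {fset G}) : {fset G} :=
  [fset g * h | h in H]%fset.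

Definition symdiff (T : choiceType) (A B : {fset T}) : {fset T} :=
  ((A `\` B) `|` (B `\` A))%fset.

(* H may be empty only if F is, because of the strict inequality. *)
Definition is_Folner (R : realType) (G : groupType) (F : {fset G}) (eps : R)
    (H : {fset G}) : Prop :=
  forall g : G, g \in F ->
    (#|` symdiff (ltranslate g H) H|%:R < eps * #|` H|%:R :> R)%R.

Definition amenable (R : realType) (G : groupType) : Prop :=
  forall (F : {fset G}) (eps : R), (0 < eps)%R ->
    exists H : {fset G}, is_Folner F eps H.

(* Main.v *)
(** A finite system, solvable in an extension of every group, whose solutions
    force non-amenability.  Let [s] and [r] have orders dividing 2 and 3, and
    let [L = <a, b>] commute with [L ^ r].  Suppose that [r * s] and [r^-1 * s]
    conjugate [L] into itself, which is a finite condition since it suffices to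
    write the conjugates of [a] and [b] as words in [a] and [b].  Suppose also
    that [L] contains two non-commuting elements whose conjugates [x], [y] by
    [s] commute with [r].  If [h] is an alternating word in [s] and [r^+-1]
    ending in [s], then [x ^ h] and [y ^ h] lie in [L], so [h * r] cannot be
    another such word; hence the words ending in [s] give a paradoxical subset
    of [<s, r>], as in the free product Z/2 * Z/3, and the paradox extends to
    the whole group coset by coset.  A solution is given by permutations of two
    copies of the Cantor set, with [L] Thompson's group F acting on one copy. *)

Require Import Defs.
From mathcomp Require Import all_boot all_algebra finmap reals.
From HB Require Import structures.
From mathcomp Require Import boolp zify.

Set Implicit Arguments.
Unset Strict Implicit.
Unset Printing Implicit Defensive.

Import GRing.Theory Num.Theory.

Local Open Scope group_scope.

(** * Evaluation of words in a group *)

Section WordGroup.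
Variables (G : groupType) (n : nat).

Definition letter_inv (l : letter G n) : letter G n :=
  match l with
  | Coef g => Coef n g^-1
  | Var i => VarInv G i
  | VarInv i => Var G i
  end.

(* Words form a group only up to evaluation; the bare operations suffice to
   write a relation once and read it both in words and in groups. *)
HB.instance Definition _ := hasMul.Build (word G n) (@cat _).
HB.instance Definition _ := hasOne.Build (word G n) [::].
HB.instance Definition _ :=
  hasInv.Build (word G n) (fun w => rev (map letter_inv w)).

Variables (K : groupType) (f : {multiplicative G -> K}) (x : 'I_n -> K).

Lemma word_valM : {morph word_val f x : v w / v * w}.
Proof. by move=> v w; rewrite /word_val big_cat. Qed.

Lemma multiplicativeV g : f g^-1 = (f g)^-1.
Proof.
have f1 : f 1 = 1 by apply: (mulgI (f 1)); rewrite -gmulfM !mulg1.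
by apply: (mulgI (f g)); rewrite -gmulfM !mulgV f1.
Qed.

Lemma word_valV : {morph word_val f x : w / w^-1}.
Proof.
move=> w; rewrite /word_val -[w^-1]/(rev (map letter_inv w)) -map_rev big_map.
rewrite -[w in RHS]revK -prodgV; apply: eq_bigr => l _.
by case: l => [g|i|i] /=; rewrite ?multiplicativeV ?invgK.
Qed.

End WordGroup.

(** * The relations and their transport along morphisms *)

Section Relations.
Variables (T : baseGroupType) (s r a b : T).

(* Intended model: permutations of the infinite binary sequences, acting on the
   right, with [a] the generator [0y |-> 00y, 10y |-> 01y, 11y |-> 1y] of
   Thompson's group F and [b] the copy of [a] on the cone 1.  Then [aw] (resp.
   [bw]) is the copy of [a] (resp. [b]) on the cone [w]; [a0] and [a10] solve
   the pentagon identities [b * a * a0 = a * a] and [a11 * b * a10 = b * b]. *)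
Definition a11 := b ^ a^-1.
Definition a10 := b^-1 * a11^-1 * b * b.
Definition a0 := a^-1 * b^-1 * a * a.
Definition b11 := a11 ^ a^-1.
Definition b10 := a10 ^ (a^-1 * b).
Definition b0 := a10 ^ a.

Definition relations : seq (T * T) :=
  [:: (s^-1, s); (r * r, r^-1);
      (a * a ^ r, a ^ r * a); (a * b ^ r, b ^ r * a);
      (b * a ^ r, a ^ r * b); (b * b ^ r, b ^ r * b);
      (a ^ (r * s), a11); (b ^ (r * s), b11);
      (a ^ (r^-1 * s), a10); (b ^ (r^-1 * s), b10);
      (a0 ^ (s * r), a0 ^ s); (b0 ^ (s * r), b0 ^ s)].

End Relations.

Section RelationsMorphism.
Variables (T U : baseGroupType) (h : T -> U).
Hypotheses (hM : {morph h : x y / x * y}) (hV : {morph h : x / x^-1}).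

Lemma a0_morph a b : a0 (h a) (h b) = h (a0 a b).
Proof. by rewrite /a0 !(hM, hV). Qed.

Lemma b0_morph a b : b0 (h a) (h b) = h (b0 a b).
Proof. by rewrite /b0 /a10 /a11 /conjg !(hM, hV). Qed.

(** Serves both the evaluation of words, which are not a group, and the inclusion of permutations
    into a direct product. *)
Lemma relations_morph s r a b :
  relations (h s) (h r) (h a) (h b) =
    [seq (h e.1, h e.2) | e <- relations s r a b].
Proof.
by rewrite /relations a0_morph b0_morph /b11 /b10 /a10 /a11 /conjg /= !(hM, hV).
Qed.

End RelationsMorphism.

(** The identity enters as [a * a^-1]. *)
Inductive gen2 (G : groupType) (a b : G) : G -> Prop :=
  | Gen2l : gen2 a b a
  | Gen2r : gen2 a b b
  | Gen2M x y : gen2 a b x -> gen2 a b y -> gen2 a b (x * y)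
  | Gen2V x : gen2 a b x -> gen2 a b x^-1.

Section Gen2.
Variable G : groupType.
Implicit Types a b x y z : G.

Lemma gen2_sub a b c d x :
  gen2 c d a -> gen2 c d b -> gen2 a b x -> gen2 c d x.
Proof. by move=> ca cb; elim=> // *; [apply: Gen2M | apply: Gen2V]. Qed.

Lemma gen2J a b x z : gen2 a b x -> gen2 (a ^ z) (b ^ z) (x ^ z).
Proof.
elim=> [||u v _ IHu _ IHv|u _ IHu]; try by constructor.
  by rewrite conjMg; apply: Gen2M.
by rewrite conjVg; apply: Gen2V.
Qed.

Lemma commute_gen2 a b x z :
  commute z a -> commute z b -> gen2 a b x -> commute z x.
Proof.
move=> za zb; elim=> // [u v _ zu _ zv|u _ zu]; first exact: commuteM.
exact: commuteV.
Qed.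

End Gen2.

(** * Ping-pong with alternating words in [s] and [r] *)

Section PingPong.
Variables (G : groupType) (s r a b : G).
Hypothesis rels : all (fun e => e.1 == e.2) (relations s r a b).
Hypothesis neq : a0 a b * b0 a b != b0 a b * a0 a b.

(** The flag tells whether the word ends in [s]. The predicate is on group elements, so one element
    may a priori carry both flags. *)
Inductive alternating : bool -> G -> Prop :=
  | Alt1 : alternating false 1
  | Alt_r : alternating false r
  | Alt_rV : alternating false r^-1
  | AltMs h : alternating false h -> alternating true (h * s)
  | AltMr h : alternating true h -> alternating false (h * r)
  | AltMrV h : alternating true h -> alternating false (h * r^-1).

Let sV : s^-1 = s. Proof. by case/andP: rels => /eqP. Qed.
Let ss : s * s = 1. Proof. by rewrite -{1}sV mulVg. Qed.
Let rr : r * r = r^-1. Proof. by case/and3P: rels => _ /eqP. Qed.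
Let rVrV : r^-1 * r^-1 = r. Proof. by rewrite -invgM rr invgK. Qed.

Let L := gen2 a b.

Let L_commute x y : L x -> L y -> commute x (y ^ r).
Proof.
case/and5P: rels => _ _ /eqP aar /eqP abr /and3P[/eqP bar /eqP bbr _].
move=> Lx /(gen2J r) Ly; apply: (commute_gen2 _ _ Ly).
  by apply/commute_sym/(commute_gen2 _ _ Lx); apply/commute_sym.
by apply/commute_sym/(commute_gen2 _ _ Lx); apply/commute_sym.
Qed.

Let L_a11 : L (a11 a b).
Proof. by rewrite /a11 /conjg; do ?constructor. Qed.
Let L_a10 : L (a10 a b).
Proof. by rewrite /a10; do ?[exact: L_a11 | constructor]. Qed.
Let L_a0 : L (a0 a b). Proof. by rewrite /a0; do ?constructor. Qed.
Let L_b0 : L (b0 a b).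
Proof. by rewrite /b0 /conjg; do ?[exact: L_a10 | constructor]. Qed.

Let LJrs x : L x -> L (x ^ (r * s)).
Proof.
move=> Lx; move: rels; do 6!case/andP=> _; case/and3P=> /eqP /= Ja /eqP /= Jb _.
apply: gen2_sub (gen2J (r * s) Lx); rewrite ?Ja ?Jb //.
by rewrite /b11 [_ ^ _]/conjg; do ?[exact: L_a11 | constructor].
Qed.

Let LJrVs x : L x -> L (x ^ (r^-1 * s)).
Proof.
move=> Lx; move: rels; do 8!case/andP=> _; case/and3P=> /eqP /= Ja /eqP /= Jb _.
apply: gen2_sub (gen2J (r^-1 * s) Lx); rewrite ?Ja ?Jb //.
by rewrite /b10 [_ ^ _]/conjg; do ?[exact: L_a10 | constructor].
Qed.

(** An initial [r] or [r^-1], if any, fixes [x]; the first [s] brings it into [L], and each further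
    block [r * s] or [r^-1 * s] keeps it there. *)
Let alternating_conj (x : G) c h : L (x ^ s) -> x ^ r = x ->
  alternating c h -> L (x ^ (if c then h else h * s)).
Proof.
move=> Lx xr; have xrV : x ^ r^-1 = x by rewrite -{1}xr conjgK.
elim=> //= [|||k _ Lk|k _ Lk].
- by rewrite mul1g.
- by rewrite conjgM xr.
- by rewrite conjgM xrV.
- by rewrite -mulgA conjgM; apply: LJrs.
- by rewrite -mulgA conjgM; apply: LJrVs.
Qed.

(* [x] and [y] below are the conjugates under [s] of [a0] and [b0]: if both
   [h] and [h * r] were alternating words ending in [s], then [x ^ (h * r)] and
   [y ^ (h * r)] would lie in the commuting subgroups [L] and [L ^ r]. *)
Lemma alternating_disjoint h : alternating true h -> ~ alternating true (h * r).
Proof.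
move=> Th Thr; pose x := a0 a b ^ s; pose y := b0 a b ^ s.
have sK z : (z ^ s) ^ s = z by rewrite -conjgM ss conjg1.
move: rels; do 10!case/andP=> _; case/and3P=> /eqP /= xr /eqP /= yr _.
rewrite !conjgM in xr yr.
have Lx : L (x ^ (h * r)) by apply: (alternating_conj _ _ Thr); rewrite ?sK.
have Ly : L (y ^ h) by apply: (alternating_conj _ _ Th); rewrite ?sK.
have := L_commute Lx Ly; rewrite -conjgM /commute -!conjMg.
by move/conjg_inj/conjg_inj/eqP; apply/negP.
Qed.

Let alternatingMs c h : alternating c h -> exists c', alternating c' (h * s).
Proof.
case: c => [|Fh]; last by exists true; constructor.
by case E: _ _ / => // [k Fk]; exists false; rewrite -mulgA ss mulg1.
Qed.

Let alternatingMr c h : alternating c h -> exists c', alternating c' (h * r).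
Proof.
case: c => [Th|Fh]; first by exists false; constructor.
case E: _ _ / Fh => // [|||k Tk|k Tk].
- by exists false; rewrite mul1g; constructor.
- by exists false; rewrite rr; constructor.
- by exists false; rewrite mulVg; constructor.
- by exists false; rewrite -mulgA rr; constructor.
- by exists true; rewrite mulgVK.
Qed.

Let alternatingMrV c h : alternating c h -> exists c', alternating c' (h * r^-1).
Proof.
by move=> /alternatingMr[d] /alternatingMr[e]; exists e; rewrite -rr mulgA.
Qed.

(** Right multiplication by a generator appends a letter, or else merges with or cancels the last
    one, by [s * s = 1] and [r * r = r^-1]. *)
Lemma gen2_alternating g : gen2 s r g -> exists c, alternating c g.
Proof.
move=> Hg; rewrite -[g]mul1g.
(* Treating [g] and [g^-1] together lets the induction pass through inverses. *)
suff [P _] : (forall c h, alternating c h -> exists d, alternating d (h * g)) /\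
    (forall c h, alternating c h -> exists d, alternating d (h * g^-1)).
  by apply: P Alt1.
elim: Hg => [||x y _ [x1 x2] _ [y1 y2]|x _ [x1 x2]].
- by rewrite sV.
- by split.
- split=> c h; first by move=> /x1[d] /y1; rewrite mulgA.
  by move=> /y2[d] /x2; rewrite -mulgA -invgM.
- by rewrite invgK.
Qed.

End PingPong.

(** * Counting a paradoxical subset inside a finite set *)

Section Folner.
Variables (G : groupType) (s r : G) (A : {pred G}).
Hypothesis A_cover : forall g, g \notin A -> s * g \in A.
Hypothesis A_disjoint : forall g, g \in A -> r * g \notin A /\ r * (r * g) \notin A.

Local Open Scope fset_scope.

Lemma ltranslateP (g x : G) (S : {fset G}) :
  (x \in ltranslate g S) = (g^-1 * x \in S).
Proof.
apply/imfsetP/idP => [[y Sy ->]|Sx]; first by rewrite mulKg.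
by exists (g^-1 * x); rewrite ?mulVKg.
Qed.

Lemma card_ltranslate (g : G) (S : {fset G}) : #|` ltranslate g S| = #|` S|.
Proof. by apply: card_imfset; apply: mulgI. Qed.

Lemma card_symdiff (T : choiceType) (B C : {fset T}) :
  #|` symdiff B C| = (#|` B `\` C| + #|` C `\` B|)%N.
Proof.
apply/eqP; rewrite (leq_card_fsetU _ _).2; apply/fdisjointP => x.
by rewrite !inE => /andP[_ ->].
Qed.

(** Let [T] be the part of [S] in [A]. Up to boundary terms, translation by [s] gives |S| <= 2|T|,
    and the disjoint translates of [T] by 1, [r], [r^-1] give 3|T| <= |S|. Three times the former
    plus twice the latter is the claim. *)
Lemma paradox_card (S : {fset G}) :
  (#|` S| <= 3 * #|` symdiff (ltranslate s S) S|
             + 2 * #|` symdiff (ltranslate r S) S|)%N.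
Proof.
pose T := [fset g in S | g \in A].
have cover : (#|` S `\` T| <= #|` T| + #|` ltranslate s S `\` S|)%N.
  rewrite -(card_ltranslate s).
  apply: leq_trans (fsubset_leq_card _) (leq_card_fsetU _ _).1.
  apply/fsubsetP => x; rewrite !(ltranslateP, inE) => /andP[+ Sx].
  rewrite Sx /= => /A_cover; rewrite mulVKg => ->.
  by case: (x \in S).
have Tr : (#|` T| <= #|` ltranslate r T `&` S| + #|` ltranslate r S `\` S|)%N.
  rewrite -(card_ltranslate r).
  apply: leq_trans (fsubset_leq_card _) (leq_card_fsetU _ _).1.
  apply/fsubsetP => x; rewrite !(ltranslateP, inE) => /andP[-> ->].
  by case: (x \in S).
have TrV : (#|` T| <= #|` ltranslate r^-1 T `&` S| + #|` S `\` ltranslate r S|)%N.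
  rewrite -(card_ltranslate r^-1 T) -(card_ltranslate r^-1 (S `\` _)).
  apply: leq_trans (fsubset_leq_card _) (leq_card_fsetU _ _).1.
  apply/fsubsetP => x; rewrite !(ltranslateP, inE) invgK mulKg => /andP[-> ->].
  by case: (x \in S).
have disj : (#|` T| + #|` ltranslate r T `&` S| + #|` ltranslate r^-1 T `&` S|
              <= #|` S|)%N.
  have /eqP <- : #|` T `|` (ltranslate r T `&` S)|
                 == (#|` T| + #|` ltranslate r T `&` S|)%N.
    rewrite (leq_card_fsetU _ _).2; apply/fdisjointP => x.
    rewrite !(ltranslateP, inE) => /andP[_ Ax]; apply/negP => /andP[/andP[_ Arx] _].
    by have [] := A_disjoint Arx; rewrite mulVKg Ax.
  have /eqP <- : #|` T `|` (ltranslate r T `&` S) `|` (ltranslate r^-1 T `&` S)|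
      == (#|` T `|` (ltranslate r T `&` S)| + #|` ltranslate r^-1 T `&` S|)%N.
    rewrite (leq_card_fsetU _ _).2; apply/fdisjointP => x.
    rewrite !(ltranslateP, inE) invgK => /orP[/andP[_ Ax]|/andP[/andP[_ Arx] _]];
      apply/negP => /andP[/andP[_ Ax'] _].
      by have [] := A_disjoint Ax; rewrite Ax'.
    by have [_] := A_disjoint Arx; rewrite mulVKg Ax'.
  apply: fsubset_leq_card; apply/fsubsetP => x; rewrite !inE.
  by case: (x \in S); rewrite ?andbF.
have Tsub : T `<=` S by apply/fsubsetP => x; rewrite !inE => /andP[].
have := cardfsD S T; rewrite (fsetIidPr Tsub) => SDT.
have := fsubset_leq_card Tsub.
rewrite !card_symdiff; lia.
Qed.

Lemma paradox_not_amenable (R : realType) : ~ amenable R G.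
Proof.
(* Here 5 = 3 + 2 is the sum of the coefficients in [paradox_card]. *)
have eps0 : (0 < 5%:R^-1 :> R)%R by rewrite invr_gt0 ltr0n.
move=> /(_ [fset s; r] _ eps0)[S HS].
have /= := HS s; have /= := HS r; rewrite !inE !eqxx orbT /=.
rewrite !(mulrC 5%:R^-1%R) !ltr_pdivlMr ?ltr0n // -!natrM !ltr_nat.
move=> /(_ isT) + /(_ isT); have := paradox_card S.
by move: #|` S| #|` symdiff _ _| #|` symdiff _ _|; lia.
Qed.

End Folner.

(** * Spreading the paradox over the left cosets of <s, r> *)

Section Orbits.
Variables (R : realType) (G : groupType) (s r a b : G).
Hypothesis rels : all (fun e => e.1 == e.2) (relations s r a b).
Hypothesis neq : a0 a b * b0 a b != b0 a b * a0 a b.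

Let coset (g : G) : pred G := fun t => `[< gen2 s r (t^-1 * g) >].

Let coset_ex g : exists t, coset g t.
Proof.
exists g; apply/asboolP; rewrite mulVg -(mulVg s).
by apply: Gen2M; do ?constructor.
Qed.

Let rep g := xchoose (coset_ex g).

Let rep_coset g : gen2 s r ((rep g)^-1 * g).
Proof. exact/asboolP/(xchooseP (coset_ex g)). Qed.

(** [xchoose] depends only on the extension of the predicate, here a left coset. *)
Let repM g h : gen2 s r h -> rep (g * h) = rep g.
Proof.
move=> Hh; apply: eq_xchoose => t; apply/asboolP/asboolP => [H|H].
  by rewrite -[g](mulgK h) mulgA; apply: Gen2M H _; apply: Gen2V.
by rewrite mulgA; apply: Gen2M.
Qed.

Lemma relations_not_amenable : ~ amenable R G.
Proof.
have [/eqP /= sV /andP[/eqP /= rr _]] := andP rels.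
have ss : s * s = 1 by rewrite -{1}sV mulVg.
have rV : r^-1 * r^-1 = r by rewrite -invgM rr invgK.
pose B g := `[< alternating s r true ((rep g)^-1 * g) >].
have Bdisj g : B g -> ~~ B (g * r).
  move=> /asboolP Bg; apply/asboolPn; rewrite repM; last by constructor.
  by rewrite mulgA; exact: (alternating_disjoint rels neq Bg).
(* Alternating words grow on the right while Følner sets are translated on the left, hence the
   inverse. *)
apply: (@paradox_not_amenable _ s r [pred g | B g^-1]) => g; rewrite !inE.
  move=> /asboolPn nBg; rewrite invgM sV; apply/asboolP.
  rewrite repM; last by constructor.
  have [[//|]] := gen2_alternating rels (rep_coset g^-1).
  by rewrite mulgA; constructor.
move=> Bg; split; apply/negP => Brg.
  by have := Bdisj _ Brg; rewrite invgM mulgVK Bg.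
by have := Bdisj _ Bg; rewrite -rV; move: Brg; rewrite !invgM -mulgA => ->.
Qed.

End Orbits.

(** * Permutation groups *)

Record bij (X : Type) := Bij {
  bij_fun :> X -> X;
  bij_inv : X -> X;
  bij_funK : cancel bij_fun bij_inv;
  bij_invK : cancel bij_inv bij_fun
}.

Section BijGroup.
Variable X : Type.
Implicit Types f g h : bij X.

(** The inverse is stored so that words in permutations compute; it is determined by the map, and
    the cancellation proofs are irrelevant. *)
Lemma bij_ext f g : f =1 g -> f = g.
Proof.
case: f g => [f f' fK f'K] [g g' gK g'K] /= /funext fg; subst g.
have f'g' : f' = g' by apply/funext => x; rewrite -{1}[x]g'K fK.
subst g'; congr Bij; exact: Prop_irrelevance.
Qed.

HB.instance Definition _ := gen_eqMixin (bij X).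
HB.instance Definition _ := gen_choiceMixin (bij X).

Definition bij_one := @Bij X id id (fun=> erefl) (fun=> erefl).
Definition bij_opp f := Bij (@bij_invK _ f) (@bij_funK _ f).
(* Permutations act on the right: [f * g] is [f] followed by [g]. *)
Definition bij_mul f g : bij X :=
  Bij (can_comp (@bij_funK _ g) (@bij_funK _ f))
      (can_comp (@bij_invK _ f) (@bij_invK _ g)).

Let mulA : associative bij_mul. Proof. by move=> f g h; apply: bij_ext. Qed.
Let mul1 : left_id bij_one bij_mul. Proof. by move=> f; apply: bij_ext. Qed.
Let mulr1 : right_id bij_one bij_mul. Proof. by move=> f; apply: bij_ext. Qed.
Let mulV : left_inverse bij_one bij_opp bij_mul.
Proof. by move=> f; apply: bij_ext => x /=; rewrite bij_invK. Qed.
Let mulrV : right_inverse bij_one bij_opp bij_mul.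
Proof. by move=> f; apply: bij_ext => x /=; rewrite bij_funK. Qed.

HB.instance Definition _ :=
  isGroup.Build (bij X) mulA mul1 mulr1 mulV mulrV.

End BijGroup.

(** * The relations as a system in four variables *)

Section System.
Variable G : groupType.

Let var (i : 'I_4) : word G 4 := [:: Var G i].
Let ws := var (@Ordinal 4 0 isT).
Let wr := var (@Ordinal 4 1 isT).
Let wa := var (@Ordinal 4 2 isT).
Let wb := var (@Ordinal 4 3 isT).

Definition paradox_system : system G 4 :=
  Inequation (a0 wa wb * b0 wa wb * (b0 wa wb * a0 wa wb)^-1)
    :: [seq Equation (e.1 * e.2^-1) | e <- relations ws wr wa wb].

Lemma solution_paradox_system (K : groupType) (f : {multiplicative G -> K})
    (x : 'I_4 -> K) (s := x (@Ordinal 4 0 isT)) (r := x (@Ordinal 4 1 isT))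
    (a := x (@Ordinal 4 2 isT)) (b := x (@Ordinal 4 3 isT)) :
  solution f paradox_system x =
    (a0 a b * b0 a b != b0 a b * a0 a b) &&
    all (fun e => e.1 == e.2) (relations s r a b).
Proof.
have hM := word_valM f x; have hV := word_valV f x.
have hvar i : x i = word_val f x (var i).
  by rewrite /word_val big_seq1.
rewrite /s /r /a /b !hvar (a0_morph hM hV) (b0_morph hM hV).
rewrite (relations_morph hM hV) /paradox_system.
move: (relations ws wr wa wb) (a0 wa wb) (b0 wa wb) => es p q.
rewrite /solution /= !(hM, hV) divg_eq1; congr (_ && _).
by rewrite !all_map; apply: eq_all => e /=; rewrite hM hV divg_eq1.
Qed.

End System.

(** * Permutations of two Cantor sets *)

Section Realization.
Implicit Types y : nat -> bool.

Definition scons (c : bool) y : nat -> bool := fun n => if n is m.+1 then y m else c.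
Definition stail y : nat -> bool := fun n => y n.+1.

Lemma scons_ind (P : (nat -> bool) -> Prop) :
  (forall c y, P (scons c y)) -> forall y, P y.
Proof.
move=> Pcons y; suff -> : y = scons (y 0) (stail y) by [].
by apply/funext; case.
Qed.

Definition rotate y :=
  if y 0 then if y 1%N then stail y else scons false (scons true (stail (stail y)))
  else scons false y.

Definition unrotate y :=
  if y 0 then scons true y
  else if y 1%N then scons true (scons false (stail (stail y))) else stail y.

Let X := (bool * (nat -> bool))%type.

Definition s_fun (x : X) : X := (~~ x.1, x.2).

(* [r] cycles the left half and the cones 11 and 10 of the right half; [a] and
   [b] act on the left half only. *)
Definition r_fun (x : X) : X :=
  let: (c, y) := x in
  if c then
    if y 0 then
      if y 1%N then (true, scons true (scons false (stail (stail y))))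
      else (false, stail (stail y))
    else x
  else (true, scons true (scons true y)).

Definition r_inv (x : X) : X :=
  let: (c, y) := x in
  if c then
    if y 0 then
      if y 1%N then (false, stail (stail y))
      else (true, scons true (scons true (stail (stail y))))
    else x
  else (true, scons true (scons false y)).

Definition lift_left (f : (nat -> bool) -> nat -> bool) (x : X) : X :=
  let: (c, y) := x in if c then x else (c, f y).

Definition on_true (f : (nat -> bool) -> nat -> bool) y :=
  if y 0 then scons true (f (stail y)) else y.

(** The generators and their inverses read at most three letters, so with these explicit each round
    trip is a computation. *)
Let cancel_prefix (f g : X -> X) :
  (forall c c0 c1 c2 y,
    let x := (c, scons c0 (scons c1 (scons c2 y))) in g (f x) = x) ->
  cancel f g.
Proof.
move=> fK [c y]; elim/scons_ind: y => c0 y; elim/scons_ind: y => c1 y.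
by elim/scons_ind: y => c2 y; apply: fK.
Qed.

Definition perm_s : bij X.
by exists s_fun s_fun; apply: cancel_prefix => -[] [] [] [].
Defined.
Definition perm_r : bij X.
by exists r_fun r_inv; apply: cancel_prefix => -[] [] [] [].
Defined.
Definition perm_a : bij X.
by exists (lift_left rotate) (lift_left unrotate);
  apply: cancel_prefix => -[] [] [] [].
Defined.
Definition perm_b : bij X.
by exists (lift_left (on_true rotate)) (lift_left (on_true unrotate));
  apply: cancel_prefix => -[] [] [] [].
Defined.

Lemma realization_neq :
  a0 perm_a perm_b * b0 perm_a perm_b != b0 perm_a perm_b * a0 perm_a perm_b.
Proof.
(* The point is 0110000... in the left half, inside the cone 0 where [a0] and [b0] act; its two
   images differ at index 1. *)
apply/eqP => /(congr1 (fun f : bij X => (f (false, fun n => (0 < n < 3)%N)).2 1%N)).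
done.
Qed.

Lemma realization_relations :
  all (fun e => e.1 == e.2) (relations perm_s perm_r perm_a perm_b).
Proof.
(* Once the half and six letters are explicit, both sides of every relation compute to the same
   point. *)
have cases (f g : bij X) :
    (forall c c0 c1 c2 c3 c4 c5 y,
      let z := scons c2 (scons c3 (scons c4 (scons c5 y))) in
      f (c, scons c0 (scons c1 z)) = g (c, scons c0 (scons c1 z))) -> f == g.
  move=> fg; apply/eqP/bij_ext => -[c y]; do 6!(move: y; elim/scons_ind=> ? y).
  exact: fg.
by do ![apply/andP; split; first by apply: cases => -[] [] [] [] [] [] [] y].
Qed.

End Realization.

Theorem proposition2p2p1 (R : realType) (G : groupType) :
  existentially_closed G -> ~ amenable R G.
Proof.
move=> ecG; have [|x] := ecG 4 (paradox_system G).
  (* The system has no coefficients, so it can be solved in the second factor of a direct product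
     extending [G]. *)
  pose K : groupType := (G * bij (bool * (nat -> bool)))%type.
  have inlM : {morph (fun g : G => (g, 1) : K) : g h / g * h}.
    by move=> g h; congr (_, _); rewrite mulg1.
  pose inl_morph := isMultiplicative.Build G K _ inlM.
  pose f : {multiplicative G -> K} := HB.pack (fun g : G => (g, 1) : K) inl_morph.
  exists K, f; split; first by move=> g h [].
  pose inr (z : bij (bool * (nat -> bool))) : K := (1, z).
  exists (fun i => nth 1 [:: inr perm_s; inr perm_r; inr perm_a; inr perm_b] i).
  have inrM : {morph inr : y z / y * z}.
    by move=> y z; congr (_, _); rewrite mulg1.
  have inrV : {morph inr : z / z^-1}.
    by move=> z; congr (_, _); rewrite invg1.
  rewrite solution_paradox_system; apply/andP; split.
    rewrite /= -!/(inr _) (a0_morph inrM inrV) (b0_morph inrM inrV) -!inrM.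
    by apply: contra realization_neq => /eqP/(congr1 snd) pq; apply/eqP.
  set rels := relations _ _ _ _.
  have -> : rels = relations (inr perm_s) (inr perm_r) (inr perm_a) (inr perm_b).
    by [].
  rewrite (relations_morph inrM inrV).
  rewrite all_map; apply: sub_all realization_relations => e /= /eqP ->.
  exact: eqxx.
rewrite (@solution_paradox_system _ _ idfun) => /andP[neq rels].
exact: relations_not_amenable rels neq.
Qed.
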